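(* Let $X_1,\dots,X_m\in\mathbb{M}_n$. Then, for all symmetric norms $\|\cdot\|$ on $\mathbb{M}_n$, $$ \left\|\,\left|\sum_{k=1}^m X_k\right|_{\mathrm{sym}}\right\|\le\sqrt{2}\,\left\|\sum_{k=1}^m |X_k|_{\mathrm{sym}}\right\|. $$
   Context: $\mathbb{M}_n$ is the space of complex $n\times n$ matrices. For $Z\in\mathbb{M}_n$, $|Z|=(Z^*Z)^{1/2}$ and $|Z|_{\mathrm{sym}}=\frac{|Z|+|Z^*|}{2}$. A symmetric norm is a unitarily invariant norm on $\mathbb{M}_n$, i.e. a norm with $\|UAV\|=\|A\|$ for all $A\in\mathbb{M}_n$ and all unitaries $U,V\in\mathbb{M}_n$. *)

(* Defs.v *)
From HB Require Import structures.
From mathcomp Require Import all_boot all_order all_algebra.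
From mathcomp Require Import complex reals.

Set Implicit Arguments.
Unset Strict Implicit.
Unset Printing Implicit Defensive.

Import Order.TTheory GRing.Theory Num.Theory.
Local Open Scope ring_scope.
Local Open Scope sesquilinear_scope.

Section MatrixAbsoluteValue.
Variables (C : numClosedFieldType) (n : nat).
Implicit Types A B X : 'M[C]_n.

Definition psdmx A : Prop :=
  A ^t* = A /\ forall v : 'rV[C]_n, 0 <= (v *m A *m v ^t*) 0 0.

(* Functional calculus along A = P^* diag(d) P with P = spectralmx A unitary and
   d = spectral_diag A; only meaningful when A is positive semidefinite, in
   which case it is the unique positive semidefinite square root
   (sqrtmx_psd, sqrtmx_sqr, sqrtmx_unique). *)
Definition sqrtmx A : 'M[C]_n :=
  (spectralmx A) ^t* *m diag_mx (map_mx sqrtC (spectral_diag A)) *m spectralmx A.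

Definition absmx X : 'M[C]_n := sqrtmx (X ^t* *m X).

Definition symabsmx X : 'M[C]_n := 2%:R^-1 *: (absmx X + absmx (X ^t*)).

Lemma psdmx_gram X : psdmx (X ^t* *m X).
Proof.
have trC m p q (M : 'M[C]_(m, p)) (N : 'M[C]_(p, q)) :
  (M *m N) ^t* = N ^t* *m M ^t* by rewrite trmx_mul map_mxM.
split=> [|v]; first by rewrite trC trmxCK.
have -> : v *m (X ^t* *m X) *m v ^t* = (v *m X ^t*) *m (v *m X ^t*) ^t*.
  by rewrite trC trmxCK !mulmxA.
rewrite mxE sumr_ge0 // => k _; rewrite !mxE; exact: mul_conjC_ge0.
Qed.

Lemma psdmx_spectral A : psdmx A ->
  A = (spectralmx A) ^t* *m diag_mx (spectral_diag A) *m spectralmx A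
  /\ forall i, 0 <= spectral_diag A 0 i.
Proof.
case=> Ah Apos.
have defA : A = (spectralmx A) ^t* *m diag_mx (spectral_diag A) *m spectralmx A.
  have /orthomx_spectralP : A \is normalmx by apply/normalmxP; rewrite Ah.
  by rewrite (invmx_unitary (spectral_unitarymx A)).
split=> // i; move: (Apos (row i (spectralmx A))).
have PP : spectralmx A *m (spectralmx A) ^t* = 1%:M.
  exact/unitarymxP/spectral_unitarymx.
have -> : (row i (spectralmx A) *m A *m (row i (spectralmx A)) ^t*) 0 0 =
    (spectralmx A *m A *m (spectralmx A) ^t*) i i.
  rewrite -row_mul !mxE; apply: eq_bigr => k _; by rewrite !mxE.
rewrite [in X in _ *m X *m _]defA !mulmxA PP mul1mx -mulmxA PP mulmx1.
by rewrite !mxE eqxx.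
Qed.

Lemma sqrtmx_psd A : psdmx A -> psdmx (sqrtmx A).
Proof.
case/psdmx_spectral=> _ d_ge0; rewrite /sqrtmx.
set P := spectralmx A; set s := map_mx sqrtC (spectral_diag A).
have s_ge0 i : 0 <= s 0 i by rewrite mxE sqrtC_ge0.
have defS : P ^t* *m diag_mx s *m P =
    (diag_mx (map_mx sqrtC s) *m P) ^t* *m (diag_mx (map_mx sqrtC s) *m P).
  rewrite trmx_mul map_mxM -!mulmxA; congr (_ *m _); rewrite !mulmxA.
  congr (_ *m _); apply/matrixP=> i j.
  rewrite tr_diag_mx map_diag_mx mulmx_diag !mxE; congr (_ *+ _).
  by rewrite /= conj_Creal ?ger0_real ?sqrtC_ge0 // -expr2 sqrtCK.
by rewrite defS; exact: psdmx_gram.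
Qed.

Lemma sqrtmx_sqr A : psdmx A -> sqrtmx A *m sqrtmx A = A.
Proof.
case/psdmx_spectral=> defA _; rewrite [RHS]defA /sqrtmx.
set P := spectralmx A.
have PP : P *m P ^t* = 1%:M by exact/unitarymxP/spectral_unitarymx.
rewrite !mulmxA -(mulmxA _ P) PP mulmx1 -(mulmxA _ (diag_mx _) (diag_mx _)) mulmx_diag.
by congr (_ *m diag_mx _ *m _); apply/rowP=> i; rewrite !mxE -expr2 sqrtCK.
Qed.

Lemma sqrtmx_unique A B : psdmx A -> psdmx B -> B *m B = A -> B = sqrtmx A.
Proof.
move=> /psdmx_spectral[defA d_ge0] /psdmx_spectral[defB b_ge0] BB.
move: defA d_ge0 defB b_ge0; rewrite /sqrtmx.
have := spectral_unitarymx A; have := spectral_unitarymx B.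
move: (spectralmx A) (spectral_diag A) (spectralmx B) (spectral_diag B).
move=> P d Q b Qu Pu defA d_ge0 defB b_ge0.
have PP := unitarymxP Pu; have QQ := unitarymxP Qu.
have PP' := mulmx1C PP; have QQ' := mulmx1C QQ.
set U := P *m Q ^t*.
have UA : diag_mx d *m U = U *m diag_mx b *m diag_mx b.
  have : P *m A *m Q ^t* = P *m (B *m B) *m Q ^t* by rewrite BB.
  rewrite defA defB /U !mulmxA PP mul1mx => ->.
  by rewrite -!mulmxA QQ mulmx1 (mulmxA Q) QQ mul1mx.
have US : diag_mx (map_mx sqrtC d) *m U = U *m diag_mx b.
  clearbody U; move: UA; rewrite -mulmxA mulmx_diag !mul_diag_mx !mul_mx_diag.
  move=> /matrixP UA; apply/matrixP=> i j; move: (UA i j); rewrite !mxE.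
  have [->|nz] := eqVneq (U i j) 0; first by rewrite !(mulr0, mul0r).
  rewrite mulrC => /(mulfI nz) ->; rewrite -expr2 mulrC; congr (_ * _).
  by rewrite sqrCK.
have := congr1 (fun M => P ^t* *m M *m Q) US.
rewrite /U !mulmxA PP' mul1mx -!mulmxA QQ' mulmx1 !mulmxA => ->.
exact: defB.
Qed.

End MatrixAbsoluteValue.

Record symmetric_norm (R : realType) (n : nat) (N : 'M[R[i]]_n -> R) : Prop := {
  symmetric_norm_triangle : forall A B, N (A + B) <= N A + N B;
  symmetric_norm_scale : forall (a : R[i]) A, N (a *: A) = Normc.normc a * N A;
  symmetric_norm_definite : forall A, N A = 0 -> A = 0;
  symmetric_norm_unitary : forall A U V : 'M[R[i]]_n,
    U \is unitarymx -> V \is unitarymx -> N (U *m A *m V) = N A }.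

(* Main.v *)
Require Import Defs.
From mathcomp Require Import all_boot all_order all_algebra.
From mathcomp Require Import complex reals.
Import Order.TTheory GRing.Theory Num.Theory.
Local Open Scope ring_scope.
Local Open Scope sesquilinear_scope.

(** Write X for the sum of the X_k, A for the sum of the |X_k^*|, B for the sum
    of the |X_k|; the right-hand norm is that of (A + B) / 2.

    If Y = V |Y| is a polar decomposition then, for every matrix W and every
    scalar t > 0,
      0 <= t (V - W/t) |Y| (V - W/t)^*
         = t |Y^*| + t^-1 W |Y| W^* - Y W^* - W Y^*,
    an arithmetic-geometric mean inequality for matrices
    ([absmx_weighted_amgm]).  The subtracted terms are additive in Y, so
    the inequality can be summed over the X_k.  Taking for W the unitary polar
    factor U of X turns the subtracted sum into 2 |X^*|, whence
    2 |X^*| <= t A + t^-1 U B U^*.  The same argument for the adjoints gives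
    2 |X| <= t B + t^-1 V A V^* with V unitary.  Adding the two ([absmx_sum_le]),
      2 (|X| + |X^*|) <= t (A + B) + t^-1 U B U^* + t^-1 V A V^*.

    A symmetric norm N is monotone on positive semidefinite matrices
    ([norm_psd_monotone]), so N(A) and N(B) are at most N(A + B), and therefore
      2 N(|X| + |X^*|) <= (t + 2/t) N(A + B).
    The factor t + 2/t is smallest at t = sqrt 2, with value 2 sqrt 2.

    Monotonicity reduces to compression by a positive contraction K: such a K is
    the mean of a unitary and its adjoint, so N(K B K) <= N(B).  If A <= B and B
    is invertible, then A = B^(1/2) K^2 B^(1/2) for a positive contraction K,
    and this matrix has the same norm as K B K because M M^* and M^* M are
    unitarily similar.  A singular B is replaced by B + e for arbitrarily small
    e > 0. *)

(** * Adjoints and positive semidefinite matrices *)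

Section Psd.
Set Implicit Arguments.
Unset Strict Implicit.
Unset Printing Implicit Defensive.
Context {C : numClosedFieldType}.

Lemma adjmxM m n p (A : 'M[C]_(m, n)) (B : 'M[C]_(n, p)) :
  (A *m B) ^t* = B ^t* *m A ^t*.
Proof. by rewrite trmx_mul map_mxM. Qed.

Lemma adjmxD m n (A B : 'M[C]_(m, n)) : (A + B) ^t* = A ^t* + B ^t*.
Proof. by rewrite linearD /= map_mxD. Qed.

Lemma adjmxZ m n (a : C) (A : 'M[C]_(m, n)) : (a *: A) ^t* = a^* *: A ^t*.
Proof. by rewrite linearZ /= map_mxZ. Qed.

Lemma adjmx1 n : (1%:M : 'M[C]_n) ^t* = 1%:M.
Proof. by rewrite trmx1 map_mx1. Qed.

Lemma adjmx_sum n m (X : 'I_m -> 'M[C]_n) :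
  (\sum_k X k) ^t* = \sum_k (X k) ^t*.
Proof. by rewrite linear_sum /= map_mx_sum. Qed.

Lemma adjmx_diag n (d : 'rV[C]_n) : (diag_mx d) ^t* = diag_mx (map_mx Num.conj d).
Proof. by rewrite tr_diag_mx map_diag_mx. Qed.

Lemma unitarymxC n (U : 'M[C]_n) : U \is unitarymx -> U ^t* *m U = 1%:M.
Proof. by move/unitarymxP/mulmx1C. Qed.

Lemma psdmx0 n : psdmx (0 : 'M[C]_n).
Proof.
by split=> [|v]; rewrite ?trmx0 ?map_mx0 // mulmx0 mul0mx mxE.
Qed.

Lemma psdmxD n (A B : 'M[C]_n) : psdmx A -> psdmx B -> psdmx (A + B).
Proof.
move=> [Ah Ap] [Bh Bp]; split=> [|v]; first by rewrite adjmxD Ah Bh.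
by rewrite mulmxDr mulmxDl mxE addr_ge0.
Qed.

Lemma psdmx_sum n m (X : 'I_m -> 'M[C]_n) :
  (forall k, psdmx (X k)) -> psdmx (\sum_k X k).
Proof.
by move=> Xp; apply: big_ind => //; [exact: psdmx0 | exact: psdmxD].
Qed.

Lemma psdmxZ n (a : C) (A : 'M[C]_n) : 0 <= a -> psdmx A -> psdmx (a *: A).
Proof.
move=> a0 [Ah Ap]; split=> [|v].
  by rewrite adjmxZ Ah conj_Creal ?ger0_real.
by rewrite -scalemxAr -scalemxAl mxE mulr_ge0.
Qed.

Lemma psdmx_congr n (A M : 'M[C]_n) : psdmx A -> psdmx (M *m A *m M ^t*).
Proof.
move=> [Ah Ap]; split=> [|v]; first by rewrite !adjmxM trmxCK Ah mulmxA.
have -> : v *m (M *m A *m M ^t*) *m v ^t* = (v *m M) *m A *m (v *m M) ^t*.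
  by rewrite adjmxM !mulmxA.
exact: Ap.
Qed.

Lemma psdmx_diag_ge0 n (A : 'M[C]_n) i : psdmx A -> 0 <= A i i.
Proof.
move=> [_ /(_ (delta_mx 0 i))]; rewrite -rowE mxE (bigD1 i) //= big1 => [|j ji].
  by rewrite !mxE !eqxx conjC1 mulr1 addr0.
by rewrite !mxE (negPf ji) andbF conjC0 mulr0.
Qed.

Lemma absmx_psd n (X : 'M[C]_n) : psdmx (absmx X).
Proof. exact/sqrtmx_psd/psdmx_gram. Qed.

Lemma absmx_unique n (X B : 'M[C]_n) :
  psdmx B -> B *m B = X ^t* *m X -> B = absmx X.
Proof. by move=> Bp; apply: sqrtmx_unique => //; exact: psdmx_gram. Qed.

(** * Polar decomposition and absolute values *)

Lemma gram_diag_eq0 m n (M : 'M[C]_(m, n)) i :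
  (M *m M ^t*) i i = 0 -> row i M = 0.
Proof.
rewrite mxE => /eqP; rewrite psumr_eq0 => [/allP z|l _]; last first.
  by rewrite !mxE mul_conjC_ge0.
apply/rowP=> j; move: (z j); rewrite mem_index_enum !mxE mul_conjC_eq0.
by move=> /(_ isT)/eqP.
Qed.

(** A square matrix with a zero row is singular, so its rows leave room for a
    further orthogonal direction. *)
Lemma unit_row_orthogonal n (Z : 'M[C]_n) i : row i Z = 0 ->
  exists2 v : 'rV[C]_n, v *m v ^t* = 1%:M & v *m Z ^t* = 0.
Proof.
move=> Zi.
have [v v_neq0 vZ] : exists2 v : 'rV_n, v != 0 & v *m Z ^t* = 0.
  apply/det0P; rewrite det_map_mx det_tr fmorph_eq0; apply/det0P.
  exists (delta_mx 0 i); last by rewrite -rowE.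
  by apply/negP=> /eqP/rowP/(_ i)/eqP; rewrite !mxE !eqxx oner_eq0.
set r := (v *m v ^t*) 0 0.
have r_gt0 : 0 < r.
  rewrite lt_def; apply/andP; split.
    apply: contra v_neq0 => /eqP/gram_diag_eq0 v0.
    by apply/eqP/rowP=> j; move/rowP/(_ j): v0; rewrite !mxE.
  by rewrite /r mxE sumr_ge0 // => l _; rewrite !mxE mul_conjC_ge0.
exists ((sqrtC r)^-1 *: v); last by rewrite -scalemxAl vZ scaler0.
have s_gt0 : 0 < (sqrtC r)^-1 by rewrite invr_gt0 sqrtC_gt0.
rewrite adjmxZ -scalemxAl -scalemxAr scalerA conj_Creal ?gtr0_real //.
rewrite [v *m _]mx11_scalar -/r scale_scalar_mx -expr2 exprVn sqrtCK mulVf //.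
by rewrite gt_eqF.
Qed.

(** When no row vanishes, W is Z with normalised rows.  Otherwise a zero row of Z
    is filled with a unit vector orthogonal to the other rows; this lowers the
    number of zero rows, and the unitary obtained for the new matrix also serves
    Z, since it is multiplied by 0 in the row that was changed. *)
Lemma orthogonal_rows_unitary n (Z : 'M[C]_n) (d : 'rV[C]_n) :
  (forall i, 0 <= d 0 i) -> Z *m Z ^t* = diag_mx d ->
  exists2 W, W \is unitarymx & Z = diag_mx (map_mx sqrtC d) *m W.
Proof.
have nonzero_case (Y : 'M[C]_n) (f : 'rV[C]_n) : (forall i, f 0 i != 0) ->
    (forall i, 0 <= f 0 i) -> Y *m Y ^t* = diag_mx f ->
    exists2 W, W \is unitarymx & Y = diag_mx (map_mx sqrtC f) *m W.
  move=> f_neq0 f_ge0 YY.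
  have s_neq0 i : sqrtC (f 0 i) != 0 by rewrite sqrtC_eq0.
  exists (diag_mx (map_mx (fun x => (sqrtC x)^-1) f) *m Y); last first.
    rewrite mulmxA mulmx_diag (_ : diag_mx _ = 1%:M) ?mul1mx //.
    by apply/matrixP=> i j; rewrite !mxE divff.
  apply/unitarymxP; rewrite adjmxM mulmxA -(mulmxA _ Y) YY adjmx_diag.
  rewrite !mulmx_diag; apply/matrixP=> i j; rewrite !mxE; congr (_ *+ _).
  rewrite conj_Creal ?ger0_real ?invr_ge0 ?sqrtC_ge0 //.
  by rewrite mulrAC -invfM -expr2 sqrtCK mulVf.
elim: {d}#|[set i | d 0 i == 0]| {-2}d (leqnn #|[set i | d 0 i == 0]|) Z
  => [|k IHk] d leqk Z d_ge0 ZZ.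
  apply: nonzero_case => // i; apply/negP=> di.
  by move: leqk; rewrite leqn0 cards_eq0 => /eqP/setP/(_ i); rewrite !inE di.
have [[i /eqP di0]|d_neq0] := altP (@existsP _ (fun i => d 0 i == 0)); last first.
  by apply: nonzero_case => // i; move/existsPn: d_neq0; apply.
have Zi : row i Z = 0 by apply: gram_diag_eq0; rewrite ZZ mxE eqxx di0.
have [v vv vZ] := unit_row_orthogonal Zi.
pose d' : 'rV_n := d + delta_mx 0 i.
pose e : 'cV[C]_n := delta_mx i 0.
have ZZ' : (Z + e *m v) *m (Z + e *m v) ^t* = diag_mx d'.
  have Zv : Z *m v ^t* = 0.
    by rewrite -[LHS]trmxCK adjmxM trmxCK vZ trmx0 map_mx0.
  rewrite adjmxD adjmxM mulmxDl !mulmxDr ZZ -!mulmxA (mulmxA v) vv mul1mx vZ.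
  rewrite mulmxA Zv mul0mx mulmx0 addr0 add0r linearD /=; congr (_ + _).
  apply/matrixP=> a b; rewrite !mxE big_ord1 !mxE !eqxx !andbT.
  case: (a =P i) (b =P i) => [->|ai] [->|bi];
    rewrite ?eqxx ?conjC1 ?conjC0 ?mulr0 ?mul0r ?mulr1 ?mulr1n ?mul0rn //.
  by case: eqP => // ib; case: bi.
have leqk' : (#|[set j | (d' 0 j == 0)%R]| <= k)%N.
  rewrite -ltnS (leq_trans _ leqk) // [X in (_ < X)%N](cardsD1 i) inE di0 eqxx.
  rewrite add1n ltnS; apply/subset_leq_card/subsetP=> j; rewrite !inE !mxE eqxx /=.
  have [->|_] := eqVneq j i; first by rewrite di0 add0r oner_eq0.
  by rewrite addr0.
have d'_ge0 j : 0 <= d' 0 j by rewrite !mxE addr_ge0 ?ler0n.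
have [W Wu WZ] := IHk d' leqk' _ d'_ge0 ZZ'.
exists W => //; apply/row_matrixP=> j; have := congr1 (row j) WZ.
rewrite !row_mul !row_diag_mx -!scalemxAl linearD /= row_mul !mxE eqxx /=.
have -> : row j e = (j == i)%:R%:M.
  by apply/rowP=> l; rewrite !mxE !ord1 eqxx andbT mulr1n.
case: eqP => [->|_]; last by rewrite addr0 mul_scalar_mx scale0r addr0.
by move=> _; rewrite Zi di0 sqrtC0 scale0r.
Qed.

(** Diagonalise X^* X = P^* diag(d) P; then P X^* has orthogonal rows of squared
    lengths d, so it is diag(sqrt d) W with W unitary, and U = W^* P. *)
Lemma polar_decomposition n (X : 'M[C]_n) :
  exists2 U, U \is unitarymx & X = U *m absmx X.
Proof.
have [defG d_ge0] := psdmx_spectral (psdmx_gram X).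
rewrite /absmx /sqrtmx; move: defG d_ge0 (spectral_unitarymx (X ^t* *m X)).
move: (spectralmx _) (spectral_diag _) => P d defG d_ge0 Pu.
have PP := unitarymxP Pu; have PP' := unitarymxC Pu.
have ZZ : (P *m X ^t*) *m (P *m X ^t*) ^t* = diag_mx d.
  by rewrite adjmxM trmxCK !mulmxA -(mulmxA P) defG !mulmxA PP mul1mx -mulmxA PP mulmx1.
have [W Wu ZW] := orthogonal_rows_unitary d_ge0 ZZ.
exists (W ^t* *m P); first by rewrite mul_unitarymx // trmxC_unitary.
rewrite !mulmxA -(mulmxA _ P) PP mulmx1.
have -> : X = (P *m X ^t*) ^t* *m P by rewrite adjmxM trmxCK -mulmxA PP' mulmx1.
rewrite ZW adjmxM adjmx_diag; congr (_ *m diag_mx _ *m _).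
by apply/rowP=> i; rewrite !mxE /= conj_Creal // ger0_real // sqrtC_ge0.
Qed.

Lemma absmx_adj_polar n (X U : 'M[C]_n) : U \is unitarymx ->
  X = U *m absmx X -> absmx (X ^t*) = U *m absmx X *m U ^t*.
Proof.
move=> Uu defX; have [Ah _] := absmx_psd X.
apply/esym/absmx_unique; first exact/psdmx_congr/absmx_psd.
move: (absmx X) Ah defX => A Ah ->; have UU := unitarymxC Uu.
by rewrite trmxCK adjmxM Ah !mulmxA -(mulmxA _ (U ^t*)) UU mulmx1.
Qed.

(** The matrix equals t (V - W/t) |Y| (V - W/t)^* where Y = V |Y|. *)
Lemma absmx_weighted_amgm n (Y W : 'M[C]_n) (t : C) : 0 < t ->
  psdmx (t *: absmx (Y ^t*) + t^-1 *: (W *m absmx Y *m W ^t*)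
         - (Y *m W ^t* + W *m Y ^t*)).
Proof.
move=> t_gt0; have [V Vu defY] := polar_decomposition Y.
have [Ah _] := absmx_psd Y.
rewrite (absmx_adj_polar Vu defY).
have := psdmxZ (ltW t_gt0) (psdmx_congr (V + (- t^-1) *: W) (absmx_psd Y)).
move: (absmx Y) Ah defY => H Hh ->.
rewrite adjmxM Hh mulmxA; congr psdmx.
rewrite adjmxD adjmxZ conj_Creal ?rpredN ?rpredV ?gtr0_real //.
rewrite !(mulmxDl, mulmxDr) -!(scalemxAl, scalemxAr) !scalerDr !scalerA.
rewrite mulrN divff ?gt_eqF // mulNr mul1r opprK !scaleN1r.
by rewrite [X in _ + X = _]addrC addrACA -opprD [W *m _ *m _ + _]addrC.
Qed.

(** With U the polar factor of the sum X, both X U^* and U X^* are |X^*|, so that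
    the summed subtracted terms of [absmx_weighted_amgm] become 2 |X^*|. *)
Lemma absmx_adj_sum_le n m (X : 'I_m -> 'M[C]_n) (t : C) : 0 < t ->
  exists2 U, U \is unitarymx &
  psdmx (t *: (\sum_k absmx ((X k) ^t*))
         + t^-1 *: (U *m (\sum_k absmx (X k)) *m U ^t*)
         - 2%:R *: absmx ((\sum_k X k) ^t*)).
Proof.
move=> t_gt0; have [U Uu defX] := polar_decomposition (\sum_k X k).
exists U => //.
have [Ah _] := absmx_psd (\sum_k X k).
have -> : 2%:R *: absmx ((\sum_k X k) ^t*) =
    (\sum_k X k) *m U ^t* + U *m (\sum_k X k) ^t*.
  rewrite (absmx_adj_polar Uu defX) [in RHS]defX adjmxM Ah mulmxA.
  by rewrite scaler_nat mulr2n.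
have := psdmx_sum (fun k => absmx_weighted_amgm (X k) U t_gt0).
congr psdmx; rewrite sumrB !big_split /= -!scaler_sumr adjmx_sum.
by rewrite mulmx_sumr !mulmx_suml mulmx_sumr.
Qed.

(** Adds [absmx_adj_sum_le] for the X_k to the same inequality for their
    adjoints; U and V are the polar factors of the sum and of its adjoint. *)
Lemma absmx_sum_le n m (X : 'I_m -> 'M[C]_n) (t : C) : 0 < t ->
  let A := \sum_k absmx ((X k) ^t*) in let B := \sum_k absmx (X k) in
  exists U V, [/\ U \is unitarymx, V \is unitarymx &
  psdmx (t *: (B + A) + t^-1 *: (U *m B *m U ^t* + V *m A *m V ^t*)
         - 2%:R *: (absmx (\sum_k X k) + absmx ((\sum_k X k) ^t*)))].
Proof.
move=> t_gt0 A B; have [U Uu leU] := absmx_adj_sum_le X t_gt0.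
have [V Vu leV] := absmx_adj_sum_le (fun k => (X k) ^t*) t_gt0.
exists U, V; split => //; rewrite -/A -/B in leU.
have defB : \sum_k absmx ((X k) ^t* ^t*) = B.
  by apply: eq_bigr => k _; rewrite trmxCK.
rewrite defB -/A -adjmx_sum trmxCK in leV.
have := psdmxD leV leU; congr psdmx.
by rewrite addrACA -opprD -scalerDr addrACA -!scalerDr [V *m _ *m _ + _]addrC.
Qed.

(** * Positive contractions, and inverses of shifted square roots *)

(** Each eigenvalue c of K in [0, 1] is the real part of c + i sqrt(1 - c^2),
    which has modulus 1. *)
Lemma contraction_mean_unitary n (K : 'M[C]_n) :
  psdmx K -> psdmx (1%:M - K *m K) ->
  exists2 W, W \is unitarymx & K = 2%:R^-1 *: (W + W ^t*).
Proof.
move=> Kp; have [defK d_ge0] := psdmx_spectral Kp; have := spectral_unitarymx K.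
move: (spectralmx K) (spectral_diag K) defK d_ge0 => P d defK d_ge0 Pu K_le1.
have PP := unitarymxP Pu; have PP' := unitarymxC Pu.
have d_le1 i : 0 <= 1 - d 0 i ^+ 2.
  have := psdmx_diag_ge0 i (psdmx_congr P K_le1).
  suff -> : P *m (1%:M - K *m K) *m P ^t* = 1%:M - diag_mx d *m diag_mx d.
    by rewrite mulmx_diag !mxE eqxx expr2.
  rewrite mulmxBr mulmxBl mulmx1 PP defK !mulmxA PP mul1mx -!mulmxA PP mulmx1.
  by rewrite (mulmxA P) PP mul1mx.
pose w : 'rV[C]_n := \row_i (d 0 i + 'i * sqrtC (1 - d 0 i ^+ 2)).
have wE i : (w 0 i)^* = d 0 i - 'i * sqrtC (1 - d 0 i ^+ 2).
  rewrite mxE rmorphD rmorphM /= conjCi !conj_Creal ?mulNr //.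
    by rewrite ger0_real // sqrtC_ge0.
  by rewrite ger0_real.
exists (P ^t* *m diag_mx w *m P).
  apply/unitarymxP; rewrite !adjmxM trmxCK !mulmxA -(mulmxA _ P) PP mulmx1.
  rewrite -(mulmxA _ (diag_mx w)) adjmx_diag mulmx_diag.
  rewrite (_ : diag_mx _ = 1%:M) ?mulmx1 //; apply/matrixP=> i j.
  rewrite mxE mxE [X in w 0 i * X]mxE wE mxE mulrC -subr_sqr exprMn sqrCi sqrtCK mxE.
  by rewrite mulN1r opprK addrC subrK.
rewrite !adjmxM trmxCK mulmxA adjmx_diag -mulmxDl -mulmxDr -linearD /= defK.
rewrite scalemxAl scalemxAr -linearZ /=; congr (_ *m diag_mx _ *m _).
apply/rowP=> i; rewrite mxE mxE [X in _ + X]mxE wE mxE.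
by rewrite addrACA subrr addr0 -(mulr2n (d 0 i)) -(mulr_natl (d 0 i)) mulKf ?pnatr_eq0.
Qed.

(** T is the square root of B + e and S its inverse; both are built on an
    eigenbasis of B, where they are explicit. *)
Lemma psdmx_shift_sqrt n (B : 'M[C]_n) (e : C) : psdmx B -> 0 < e ->
  exists T S : 'M[C]_n, [/\ T ^t* = T, S ^t* = S, S *m T = 1%:M &
                            T *m T = B + e%:M].
Proof.
move=> Bp e_gt0; have [defB d_ge0] := psdmx_spectral Bp; have := spectral_unitarymx B.
move: (spectralmx B) (spectral_diag B) defB d_ge0 => P d defB d_ge0 Pu.
have PP := unitarymxP Pu; have PP' := unitarymxC Pu.
have de_gt0 i : 0 < d 0 i + e by rewrite ltr_wpDl.
pose s : 'rV[C]_n := \row_i sqrtC (d 0 i + e).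
have s_gt0 i : 0 < s 0 i by rewrite mxE sqrtC_gt0.
have conjP (u v : 'rV[C]_n) : (P ^t* *m diag_mx u *m P) *m (P ^t* *m diag_mx v *m P) =
    P ^t* *m (diag_mx u *m diag_mx v) *m P.
  by rewrite !mulmxA -(mulmxA _ P) PP mulmx1.
have adjP (u : 'rV[C]_n) : (forall i, 0 < u 0 i) ->
    (P ^t* *m diag_mx u *m P) ^t* = P ^t* *m diag_mx u *m P.
  move=> u_gt0; rewrite !adjmxM trmxCK adjmx_diag mulmxA; congr (_ *m diag_mx _ *m _).
  by apply/rowP=> i; rewrite mxE /= conj_Creal // gtr0_real.
exists (P ^t* *m diag_mx s *m P), (P ^t* *m diag_mx (map_mx GRing.inv s) *m P).
split; rewrite ?adjP ?conjP //.
- by move=> i; rewrite mxE invr_gt0.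
- rewrite mulmx_diag (_ : diag_mx _ = 1%:M) ?mulmx1 //.
  by apply/matrixP=> i j; rewrite !mxE mulVf // sqrtC_eq0 gt_eqF.
rewrite mulmx_diag (_ : diag_mx _ = diag_mx d + e%:M).
  by rewrite mulmxDr mulmxDl -defB -scalemx1 -scalemxAr mulmx1 -scalemxAl PP'.
by apply/matrixP=> i j; rewrite !mxE -expr2 sqrtCK mulrnDl.
Qed.

End Psd.

(** * Symmetric norms *)

Section Norm.
Set Implicit Arguments.
Unset Strict Implicit.
Unset Printing Implicit Defensive.
Variables (R : realType) (n : nat) (N : 'M[R[i]]_n -> R).
Hypothesis hN : symmetric_norm N.
Implicit Types A B : 'M[R[i]]_n.

Lemma norm_realZ (a : R) A : 0 <= a -> N (a%:C%C *: A) = a * N A.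
Proof.
move=> a0; rewrite (symmetric_norm_scale hN) /=.
by rewrite /Normc.normc /= expr0n addr0 sqrtr_sqr ger0_norm.
Qed.

Lemma norm_natZ (a : nat) A : N (a%:R *: A) = a%:R * N A.
Proof. by rewrite -norm_realZ // rmorph_nat. Qed.

Lemma norm_half A : N (2%:R^-1 *: A) = 2%:R^-1 * N A.
Proof. by rewrite -norm_realZ ?invr_ge0 // fmorphV rmorph_nat. Qed.

Lemma norm_conj A (U : 'M[R[i]]_n) : U \is unitarymx -> N (U *m A *m U ^t*) = N A.
Proof. by move=> Uu; rewrite (symmetric_norm_unitary hN) ?trmxC_unitary. Qed.

(** If A = U |A| then A A^* = U (A^* A) U^*. *)
Lemma norm_gramC A : N (A *m A ^t*) = N (A ^t* *m A).
Proof.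
have [U Uu] := polar_decomposition A; have [Ah _] := absmx_psd A.
move: (absmx A) Ah => H Hh ->; have UU := unitarymxC Uu.
rewrite !adjmxM Hh !mulmxA -(mulmxA _ (U ^t*)) UU.
by rewrite mulmx1 -(mulmxA U) norm_conj.
Qed.

(** With K = (W^* + W) / 2, the matrix K A K is the mean of four unitary
    transforms of A. *)
Lemma norm_contraction K A : psdmx K -> psdmx (1%:M - K *m K) ->
  N (K *m A *m K) <= N A.
Proof.
move=> Kp K1; have [W Wu ->] := contraction_mean_unitary Kp K1.
have Wu' : W ^t* \is unitarymx by rewrite trmxC_unitary.
have Nmean B D : N B <= N A -> N D <= N A -> N (2%:R^-1 *: (B + D)) <= N A.
  move=> BA DA; rewrite norm_half mulrC ler_pdivrMr // mulr_natr mulr2n.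
  by rewrite (le_trans (symmetric_norm_triangle hN _ _)) // lerD.
rewrite -scalemxAl -scalemxAl -scalemxAr mulmxDr mulmxDl.
have -> : (W *m A + W ^t* *m A) *m W = W *m A *m W + W ^t* *m A *m W by rewrite mulmxDl.
have -> : (W *m A + W ^t* *m A) *m W ^t* = W *m A *m W ^t* + W ^t* *m A *m W ^t*.
  by rewrite mulmxDl.
have Ninv U V : U \is unitarymx -> V \is unitarymx -> N (U *m A *m V) <= N A.
  by move=> U_u V_u; rewrite (symmetric_norm_unitary hN A U_u V_u).
rewrite [X in _ *: X]scalerDr; apply: (Nmean); apply: (Nmean).
- exact: (Ninv _ _ Wu Wu).
- exact: (Ninv _ _ Wu' Wu).
- exact: (Ninv _ _ Wu Wu').
- exact: (Ninv _ _ Wu' Wu').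
Qed.

(** With T^2 = B + e and S = T^-1, the matrix S A S is a positive contraction K^2,
    so A = (K T)^* (K T) has the norm of (K T) (K T)^* = K (B + e) K. *)
Lemma norm_psd_monotone A B : psdmx A -> psdmx (B - A) -> N A <= N B.
Proof.
move=> Ap BAp.
suff lee (e : R) : 0 < e -> N A <= N B + e * N 1%:M.
  apply/ler_addgt0Pr => e e_gt0.
  have K_gt0 : 0 < `|N 1%:M| + 1 by rewrite ltr_wpDl.
  apply: le_trans (lee _ (divr_gt0 e_gt0 K_gt0)) _; rewrite lerD2l.
  rewrite mulrAC ler_pdivrMr // ler_pM2l //.
  by rewrite (le_trans (ler_norm _)) // lerDl.
move=> e_gt0; have Bp : psdmx B by rewrite -(subrK A B); exact: psdmxD.
have eC_gt0 : 0 < e%:C%C by rewrite ltcR.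
have [T [S [Th Sh ST TT]]] := psdmx_shift_sqrt Bp eC_gt0.
have TS := mulmx1C ST.
pose K := sqrtmx (S *m A *m S).
have SASp : psdmx (S *m A *m S) by rewrite -{2}Sh; exact: psdmx_congr.
have Kp : psdmx K := sqrtmx_psd SASp; have KK : K *m K = S *m A *m S := sqrtmx_sqr SASp.
have Kle1 : psdmx (1%:M - K *m K).
  have -> : 1%:M - K *m K = S *m ((B - A) + e%:C%C *: 1%:M) *m S ^t*.
    rewrite addrAC scalemx1 -TT mulmxBr mulmxBl Sh KK; congr (_ - _).
    by rewrite mulmxA ST mul1mx TS.
  have p1 : psdmx (1%:M : 'M[R[i]]_n).
    by have := psdmx_gram (1%:M : 'M[R[i]]_n); rewrite mulmx1 adjmx1.
  exact: (psdmx_congr _ (psdmxD BAp (psdmxZ (ltW eC_gt0) p1))).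
have -> : N A = N (K *m (B + e%:C%C%:M) *m K).
  have [Kh _] := Kp.
  have -> : K *m (B + e%:C%C%:M) *m K = (K *m T) *m (K *m T) ^t*.
    by rewrite adjmxM Kh Th -TT !mulmxA.
  rewrite norm_gramC adjmxM Kh Th mulmxA -(mulmxA T) KK !mulmxA TS mul1mx.
  by rewrite -mulmxA ST mulmx1.
apply: le_trans (norm_contraction _ Kp Kle1) _.
apply: le_trans (symmetric_norm_triangle hN _ _) _.
by rewrite -(scalemx1 _ e%:C%C) norm_realZ ?(ltW e_gt0).
Qed.

End Norm.

Theorem corollary2p5 (R : realType) (n m : nat) (X : 'I_m -> 'M[R[i]]_n)
  (N : 'M[R[i]]_n -> R) (hN : symmetric_norm N) :
  N (symabsmx (\sum_(k < m) X k)) <=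
    Num.sqrt 2%:R * N (\sum_(k < m) symabsmx (X k)).
Proof.
set A := \sum_k absmx ((X k) ^t*); set B := \sum_k absmx (X k).
pose t : R := Num.sqrt 2%:R.
have t_gt0 : 0 < t by rewrite sqrtr_gt0.
have tC_gt0 : 0 < t%:C%C by rewrite ltcR.
have Ap : psdmx A by apply: psdmx_sum => k; exact: absmx_psd.
have Bp : psdmx B by apply: psdmx_sum => k; exact: absmx_psd.
have [U [V [Uu Vu leUV]]] := absmx_sum_le X tC_gt0; rewrite -/A -/B in leUV.
have -> : \sum_k symabsmx (X k) = 2%:R^-1 *: (B + A).
  by rewrite -big_split scaler_sumr.
rewrite /symabsmx !(norm_half hN) mulrCA ler_pM2l ?invr_gt0 // -/t.
rewrite -(ler_pM2l (ltr0Sn _ 1)) -(norm_natZ hN).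
have NA : N A <= N (B + A).
  by apply: (norm_psd_monotone hN Ap); move: Bp; rewrite -{1}(addrK A B).
have NB : N B <= N (B + A).
  by apply: (norm_psd_monotone hN Bp); move: Ap; rewrite -{1}(addrK B A) [A + B]addrC.
have lhs_psd := psdmxZ (ler0n R[i] 2)
  (psdmxD (absmx_psd (\sum_k X k)) (absmx_psd ((\sum_k X k) ^t*))).
apply: le_trans (norm_psd_monotone hN lhs_psd leUV) _.
apply: le_trans (symmetric_norm_triangle hN _ _) _.
(* At t = sqrt 2 both terms of the bound contribute sqrt 2 N(A + B). *)
rewrite -fmorphV !(norm_realZ hN) ?invr_ge0 ?(ltW t_gt0) //.
rewrite [2%:R * _]mulr_natl mulr2n lerD2l mulrC ler_pdivrMr // mulrAC -expr2.
rewrite sqr_sqrtr // mulr_natl mulr2n.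
apply: le_trans (symmetric_norm_triangle hN _ _) _.
by rewrite (norm_conj hN B Uu) (norm_conj hN A Vu) lerD.
Qed.
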